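(* Indecomposable projective-injective objects in the Frobenius category $\mathcal{F}_\pi$ are isomorphic to $E(x,x)$ for some $x$.
   Context: $R$ is a discrete valuation ring with uniformizing parameter $t$. $S^1=\mathbb{R}/2\pi\mathbb{Z}$, and for $x\in\mathbb{R}$ the class of $x$ in $S^1$ is $[x]$. A representation $V$ of $S^1$ over $R$ consists of an $R$-module $V[x]$ for every $[x]\in S^1$ and an $R$-linear map $V^{(x,\alpha)}:V[x]\to V[x-\alpha]$ for every $[x]\in S^1$ and real $\alpha\ge 0$ (depending only on $[x]$ and $\alpha$), such that $V^{(x-\beta,\alpha)}\circ V^{(x,\beta)}=V^{(x,\alpha+\beta)}$ for all $\alpha,\beta\ge 0$, and $V^{(x,2\pi n)}:V[x]\to V[x]$ is multiplication by $t^n$ for all $n\in\mathbb{N}$. A morphism $f:V\to W$ is a family of $R$-linear maps $f_{[x]}:V[x]\to W[x]$ with $W^{(x,\alpha)}f_{[x]}=f_{[x-\alpha]}V^{(x,\alpha)}$. Monomorphisms, epimorphisms, exactness and direct sums are taken pointwise; a representation is projective if morphisms from it lift through all epimorphisms. $P_{[x]}$ is the representation with $P_{[x]}[x-\alpha]=Re_x^\alpha$ free on one generator $e_x^\alpha$ for $0\le\alpha<2\pi$; for $n\in\mathbb{N}$ put $e_x^{\gamma+2\pi n}:=t^ne_x^\gamma$; write $e_x=e_x^0$; the structure maps are $P_{[x]}^{(x-\alpha,\beta)}(e_x^\alpha)=e_x^{\alpha+\beta}$. A representation is finitely generated if it is a quotient of a finite direct sum of representations $P_{[x_i]}$. $\mathcal{P}_{S^1}$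 is the category of all finitely generated projective representations of $S^1$ over $R$. The category $\mathcal{F}_\pi$: objects are pairs $(V,d)$ with $V\in\mathcal{P}_{S^1}$ and $d:V\to V$ an endomorphism with $d^2=t$ (multiplication by $t$); morphisms $(V,d)\to(W,d)$ are morphisms $f:V\to W$ with $fd=df$. Exact sequences in $\mathcal{F}_\pi$ are the sequences $(X,d)\xrightarrow{f}(Y,d)\xrightarrow{g}(Z,d)$ such that $0\to X\xrightarrow{f}Y\xrightarrow{g}Z\to 0$ is exact (hence split exact) in $\mathcal{P}_{S^1}$. With this exact structure $\mathcal{F}_\pi$ is a Frobenius category; projective and injective are meant with respect to this exact structure. For real numbers $x\le y\le x+2\pi$ put $\alpha=y-x$, $\beta=x+2\pi-y$ and $E(x,y)=\left(P_{[x]}\oplus P_{[y]},\ d=\begin{bmatrix}0&\beta_*\\ \alpha_*&0\end{bmatrix}\right)\in\mathcal{F}_\pi$, where $\alpha_*:P_{[x]}\to P_{[y]}$ is the morphism with $\alpha_*(e_x)=e_y^\alpha$ and $\beta_*:P_{[y]}\to P_{[x]}$ is the morphism with $\beta_*(e_y)=e_x^\beta$. In particular $E(x,x)=\left(P_{[x]}\oplus P_{[x]},\begin{bmatrix}0&t\\1&0\end{bmatrix}\right)$. *)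

(* Defs.v *)
From HB Require Import structures.
From mathcomp Require Import all_boot all_order all_algebra.
From mathcomp Require Import reals trigo.
From mathcomp Require Import zify ring lra.

Set Implicit Arguments.
Unset Strict Implicit.
Unset Printing Implicit Defensive.

Import Order.TTheory GRing.Theory Num.Theory.
Local Open Scope ring_scope.
Local Open Scope quotient_scope.

(* [idealr_closed I] says that I is a proper ideal; the unit ideal, missing from
   the first clause of [is_dvr], is generated by 1.  Since ideals are boolean
   predicates, these definitions are meant under classical axioms, where every
   subset of R is one. *)

Section DVR.
Variable R : idomainType.

Definition generates (I : {pred R}) (a : R) :=
  forall x, x \in I <-> exists r, x = r * a.

Definition maximal_ideal (M : {pred R}) :=
  idealr_closed M /\
  forall J : {pred R}, idealr_closed J -> {subset M <= J} -> J =i M.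

Definition is_dvr : Prop :=
  [/\ forall I : {pred R}, idealr_closed I -> exists a, generates I a,
      exists2 M : {pred R}, maximal_ideal M &
        forall N : {pred R}, maximal_ideal N -> N =i M
    & exists2 x : R, x != 0 & x \isn't a GRing.unit].

Definition is_uniformizer (t : R) : Prop :=
  forall M : {pred R}, maximal_ideal M -> generates M t.

End DVR.

Section Circle.
Variable RR : realType.

Definition period : RR := 2 * pi.

Lemma period_gt0 : 0 < period.
Proof. by rewrite /period mulr_gt0 ?pi_gt0. Qed.

Definition periods : {pred RR} := [pred x | x / period \is a Num.int].

Lemma periods_closed : zmod_closed periods.
Proof.
split=> [|x y]; rewrite !inE ?mul0r ?rpred0 // => hx hy.
by rewrite mulrBl rpredB.
Qed.

HB.instance Definition _ := GRing.isZmodClosed.Build RR periods periods_closed.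

(* The additive group RR / (2 pi Z). *)
Definition circle : zmodType := Quotient.quot periods.

Definition cls (x : RR) : circle := \pi_(Quotient.quot periods) x.

Lemma clsB : {morph cls : x y / x - y}.
Proof. by move=> x y; rewrite /cls !piE. Qed.
Lemma clsD : {morph cls : x y / x + y}.
Proof. by move=> x y; rewrite /cls !piE. Qed.
Lemma cls0 : cls 0 = 0.
Proof. by rewrite /cls !piE. Qed.

Lemma cls_eq0 x : (cls x == 0) = (x / period \is a Num.int).
Proof.
rewrite -cls0 /cls.
have := @Quotient.idealrBE RR periods x 0.
by rewrite subr0 inE => ->.
Qed.

(* The number of full turns in an angle a >= 0. *)
Definition turns (a : RR) : nat := Num.truncn (a / period).

(* The representative of a class in [0, 2 pi[. *)
Definition angle (s : circle) : RR :=
  let x : RR := repr (s : Quotient.quot periods) in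
  x - (Num.floor (x / period))%:~R * period.

Lemma cls_int (n : int) : cls (n%:~R * period) = 0.
Proof. by apply/eqP; rewrite cls_eq0 mulfK ?gt_eqF ?period_gt0 ?intr_int. Qed.

Lemma cls_period : cls period = 0.
Proof. by rewrite -[period]mul1r (cls_int 1). Qed.

Lemma angleK s : cls (angle s) = s.
Proof. by rewrite /angle clsB cls_int subr0 /cls reprK. Qed.

Lemma angle_itv s : 0 <= angle s < period.
Proof.
rewrite /angle; set x : RR := repr _.
have p0 := period_gt0.
have -> : x - (Num.floor (x / period))%:~R * period =
    (x / period - (Num.floor (x / period))%:~R) * period.
  by rewrite mulrBl divfK ?gt_eqF.
have /andP[h1 h2] := floor_itv (x / period).
apply/andP; split; first by rewrite mulr_ge0 ?subr_ge0 ?(ltW p0).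
by rewrite gtr_pMl // ltrBlDr addrC; move: h2; rewrite intrD.
Qed.

Lemma angle_ge0 s : 0 <= angle s.
Proof. by case/andP: (angle_itv s). Qed.

Lemma angle_uniq (u v : RR) : 0 <= u < period -> 0 <= v < period ->
  cls u = cls v -> u = v.
Proof.
move=> /andP[u0 u1] /andP[v0 v1] /eqP.
have p0 := period_gt0.
rewrite -subr_eq0 -clsB cls_eq0 => /intrP[n nE].
have uvE : u - v = n%:~R * period by rewrite -nE divfK ?gt_eqF.
have n1 : n < 1.
  rewrite -(ltr_int RR) -(ltr_pM2r p0) -uvE mul1r; lra.
have n2 : -1 < n.
  rewrite -(ltr_int RR) -(ltr_pM2r p0) -uvE mulN1r; lra.
have n0 : n = 0 by lia.
by apply/eqP; rewrite -subr_eq0 uvE n0 mul0r.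
Qed.

Lemma angle_cls a : 0 <= a -> angle (cls a) = a - (turns a)%:R * period.
Proof.
move=> a0; have p0 := period_gt0.
have ap0 : 0 <= a / period by rewrite divr_ge0 // ltW.
apply: angle_uniq; first exact: angle_itv.
  have -> : a - (turns a)%:R * period = (a / period - (turns a)%:R) * period.
    by rewrite mulrBl divfK ?gt_eqF.
  have /andP[h1 h2] := truncn_itv ap0.
  apply/andP; split; first by rewrite mulr_ge0 ?subr_ge0 ?(ltW p0).
  by rewrite gtr_pMl // ltrBlDr addrC natr1.
by rewrite angleK clsB (cls_int (turns a)) subr0.
Qed.

Lemma turnsMD (n : nat) a : 0 <= a -> turns (n%:R * period + a) = (n + turns a)%N.
Proof.
move=> a0; have p0 := period_gt0.
rewrite /turns mulrDl mulfK ?gt_eqF // truncnD ?natrK //.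
by rewrite nnegrE divr_ge0 // ltW.
Qed.

Lemma turnsE a : 0 <= a -> a = (turns a)%:R * period + angle (cls a).
Proof. by move=> a0; rewrite angle_cls // addrC subrK. Qed.

Lemma turns_small a : 0 <= a < period -> turns a = 0%N.
Proof.
move=> /andP[a0 a1]; have p0 := period_gt0.
by apply: truncn_def; rewrite ltr_pdivrMr // mul1r a1 divr_ge0 // ltW.
Qed.

Lemma turns0 : turns 0 = 0%N.
Proof. by rewrite /turns mul0r truncn0. Qed.

Lemma turns_period : turns period = 1%N.
Proof. by rewrite /turns divff ?truncn1 // gt_eqF // period_gt0. Qed.

(* The index condition of the structure maps; as it is a boolean, the map from
   p to q = p - [a] cannot depend on the proof. *)
Definition step (a : RR) (p q : circle) : bool := (0 <= a) && (q == p - cls a).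

Lemma step_ge0 a p q : step a p q -> 0 <= a.
Proof. by case/andP. Qed.

Lemma step_eq a p q : step a p q -> q = p - cls a.
Proof. by case/andP=> _ /eqP. Qed.

Lemma step_trans a b p q r : step b p q -> step a q r -> step (a + b) p r.
Proof.
move=> /andP[b0 /eqP ->] /andP[a0 /eqP ->]; rewrite /step addr_ge0 //=.
by rewrite clsD opprD addrCA addrC.
Qed.

Lemma step0 p : step 0 p p.
Proof. by rewrite /step lexx cls0 subr0 /=. Qed.

Lemma step_loop n p : step (n%:R * period) p p.
Proof.
have e : cls (n%:R * period) = 0 by exact: (cls_int n).
by rewrite /step e subr0 eqxx andbT mulr_ge0 ?ler0n // ltW // period_gt0.
Qed.

Lemma step_angle p q : step (angle (p - q)) p q.
Proof. by rewrite /step angle_ge0 angleK subKr /=. Qed.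

Lemma step_cls (x y z : RR) : 0 <= x -> y - x = z -> step x (cls y) (cls z).
Proof. by move=> x0 <-; rewrite /step x0 clsB /=. Qed.

Lemma angle_step a p q r : step a q r ->
  cls (angle (p - q) + a) = p - r.
Proof. by move=> /step_eq ->; rewrite clsD angleK opprB addrA addrAC. Qed.

Lemma turns_step a b p q r : step a q r -> 0 <= b ->
  (turns (angle (p - q) + a) + turns (angle (p - r) + b))%N =
    turns (angle (p - q) + (b + a)).
Proof.
move=> h b0; have a0 := step_ge0 h.
have Aa0 : 0 <= angle (p - q) + a by rewrite addr_ge0 ?angle_ge0.
rewrite addrCA [in RHS]addrC [in RHS](turnsE Aa0) (angle_step _ h) -[in RHS]addrA.
by rewrite turnsMD // addr_ge0 ?angle_ge0.
Qed.

End Circle.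

Section Representations.
Variables (RR : realType) (R : idomainType) (t : R).
Local Notation S1 := (circle RR).
Local Notation period := (period RR).

Record rep := Rep {
  module :> S1 -> lmodType R;
  rmap : forall (a : RR) (p q : S1), step a p q -> {linear module p -> module q};
  rmap_comp : forall (a b : RR) (p q r : S1)
      (hb : step b p q) (ha : step a q r) (hab : step (a + b) p r) v,
    rmap ha (rmap hb v) = rmap hab v;
  rmap_loop : forall (n : nat) (p : S1) (h : step (n%:R * period) p p) v,
    rmap h v = t ^+ n *: v }.

Record hom (V W : rep) := Hom {
  hom_fun :> forall p : S1, {linear V p -> W p};
  hom_nat : forall (a : RR) (p q : S1) (h : step a p q) v,
    rmap W h (hom_fun p v) = hom_fun q (rmap V h v) }.

Lemma rmap_eq (V : rep) a b p q (h : step a p q) (k : step b p q) v :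
  a = b -> rmap V h v = rmap V k v.
Proof. by move=> e; subst b; rewrite (bool_irrelevance h k). Qed.

Lemma rmap0 (V : rep) p (h : step 0 p p) v : rmap V h v = v.
Proof.
rewrite (rmap_eq h (step_loop 0 p)) ?mul0r //.
by rewrite rmap_loop expr0 scale1r.
Qed.

Definition mono V W (f : hom V W) := forall p, injective (f p).
Definition epi V W (f : hom V W) := forall p w, exists v, f p v = w.

Definition projective (V : rep) := forall (X Y : rep) (g : hom X Y) (f : hom V Y),
  epi g -> exists h : hom V X, forall p v, g p (h p v) = f p v.

Definition hom_id V : hom V V.
Proof. by exists (fun p => idfun). Defined.

Definition hom_comp U V W (g : hom V W) (f : hom U V) : hom U W.
Proof.
exists (fun p => g p \o f p) => a p q h v /=.
by rewrite !hom_nat.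
Defined.

Definition hom_scale V (c : R) : hom V V.
Proof.
exists (fun p => c \*: idfun) => a p q h v /=.
by rewrite linearZ.
Defined.

Definition pair_fun (U V U' V' : lmodType R) (f : U -> U') (g : V -> V')
  (x : (U * V)%type) : (U' * V')%type := (f x.1, g x.2).

Lemma pair_fun_linear (U V U' V' : lmodType R)
  (f : {linear U -> U'}) (g : {linear V -> V'}) : linear (pair_fun f g).
Proof. by move=> c x y; rewrite /pair_fun /= !linearP. Qed.

HB.instance Definition _ (U V U' V' : lmodType R)
  (f : {linear U -> U'}) (g : {linear V -> V'}) :=
  GRing.isLinear.Build R (U * V)%type (U' * V')%type _ (pair_fun f g)
    (pair_fun_linear f g).

Definition dsum (V W : rep) : rep.
Proof.
exists (fun p => (V p * W p)%type : lmodType R)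
  (fun a p q h => pair_fun (rmap V h) (rmap W h)).
- move=> a b p q r hb ha hab v; rewrite /= /pair_fun /=.
  by rewrite !(rmap_comp hb ha hab).
- by move=> n p h [v w]; rewrite /= /pair_fun /= !rmap_loop.
Defined.

Definition rep0 : rep.
Proof.
exists (fun _ => 'rV[R]_0 : lmodType R) (fun a p q h => idfun) => //.
by move=> n p h v; rewrite /= !thinmx0.
Defined.

Definition hom_dsum V W V' W' (f : hom V V') (g : hom W W') :
  hom (dsum V W) (dsum V' W').
Proof.
exists (fun p => pair_fun (f p) (g p) :
  {linear (V p * W p)%type -> (V' p * W' p)%type}) => a p q h v /=.
by rewrite /pair_fun /= !hom_nat.
Defined.

(* The representations P_p.  The module at q is R^o, with 1 standing for the
   generator e_p^a with 0 <= a < 2 pi and q = p - [a], that is a = angle (p - q). *)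

Definition P (p : S1) : rep.
Proof.
exists (fun _ => R^o : lmodType R)
  (fun a q r _ => *:%R (t ^+ turns (angle (p - q) + a)) : {linear R^o -> R^o}).
- move=> a b q r s hb ha hab v /=.
  by rewrite scalerA -exprD addnC (turns_step _ hb) // (step_ge0 ha).
- move=> n q h v /=; rewrite addrC turnsMD ?angle_ge0 //.
  by rewrite turns_small ?angle_itv ?addn0.
Defined.

(* The element e_p^a of P_p at p - [a], for any a >= 0. *)
Definition gen (a : RR) (p q : S1) (h : step a p q) : P p q := t ^+ turns a.

Lemma rmap_gen a b p q r (hb : step b p q) (ha : step a q r)
    (hab : step (a + b) p r) : rmap (P p) ha (gen hb) = gen hab.
Proof.
rewrite /gen /= /GRing.scale /= -exprD.
have b0 := step_ge0 hb; have a0 := step_ge0 ha.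
rewrite [in RHS](turnsE b0) (step_eq hb) subKr addrCA turnsMD.
  by rewrite addnC [a + _]addrC.
by rewrite addr_ge0 ?angle_ge0.
Qed.

Lemma gen1 p q : gen (step_angle p q) = 1.
Proof. by rewrite /gen turns_small ?angle_itv. Qed.

(* The morphism P_p -> V sending e_p to v. *)

Definition scale_vec (V : lmodType R) (v : V) (c : R^o) : V := c *: v.

Lemma scale_vec_linear (V : lmodType R) (v : V) : linear (scale_vec v).
Proof. by move=> c x y; rewrite /scale_vec scalerDl scalerA. Qed.

HB.instance Definition _ (V : lmodType R) (v : V) :=
  GRing.isLinear.Build R R^o V _ (scale_vec v) (scale_vec_linear v).

Definition hom_gen (V : rep) (p : S1) (v : V p) : hom (P p) V.
Proof.
exists (fun q => scale_vec (rmap V (step_angle p q) v) : {linear R^o -> V q}) => a q r h c /=.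
rewrite /scale_vec linearZ /= (rmap_comp _ _ (step_trans (step_angle p q) h)).
set n := turns _; set Aa := step_trans _ h.
have e : a + angle (p - q) = n%:R * period + angle (p - r).
  rewrite addrC /n -(angle_step p h); apply: turnsE.
  by rewrite addr_ge0 ?angle_ge0 // (step_ge0 h).
rewrite (rmap_eq Aa (step_trans (step_angle p r) (step_loop n r)) v e).
by rewrite -(rmap_comp (step_angle p r) (step_loop n r)) rmap_loop scalerA mulrC.
Defined.

Lemma hom_genE (V : rep) p (v : V p) : hom_gen v p (gen (step0 p)) = v.
Proof.
have z : angle (p - p) = 0 :> RR.
  rewrite subrr -(cls0 RR) angle_cls // /turns mul0r truncn0 mul0r subr0 //.
rewrite /= /scale_vec /gen /turns mul0r truncn0 expr0 scale1r.
by rewrite (rmap_eq _ (step0 p)) ?rmap0.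
Qed.

Lemma hom_gen_uniq (V : rep) p (f g : hom (P p) V) :
  f p (gen (step0 p)) = g p (gen (step0 p)) -> forall q v, f q v = g q v.
Proof.
move=> e q v; have -> : v = v *: (1 : R^o) by rewrite /GRing.scale /= mulr1.
rewrite !linearZ /=; congr (_ *: _); rewrite -[1](gen1 p q).
have h : step (angle (p - q) + 0) p q by rewrite addr0 step_angle.
have -> : gen (step_angle p q) = gen h by rewrite /gen addr0.
by rewrite -(rmap_gen (step0 p) (step_angle p q)) -!hom_nat e.
Qed.

(* The morphism a_* : P_p -> P_q with a_* (e_p) = e_q^a, where p = q - [a]. *)
Definition push (a : RR) (p q : S1) (h : step a q p) : hom (P p) (P q) :=
  hom_gen (gen h).

Lemma push_gen a p q (h : step a q p) : push h p (gen (step0 p)) = gen h.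
Proof. exact: hom_genE. Qed.

Lemma push_push a b p q (h : step a q p) (k : step b p q) v s :
  a + b = period -> push k s (push h s v) = t *: v.
Proof.
move=> ab; apply: (hom_gen_uniq (f := hom_comp (push k) (push h))
  (g := hom_scale _ t)).
rewrite -[LHS]/(push k p (push h p (gen (step0 p)))) push_gen.
have hr : step (a + 0) q p by rewrite addr0.
have -> : gen h = rmap (P q) h (gen (step0 q)).
  by rewrite (rmap_gen _ _ hr) /gen addr0.
rewrite -hom_nat push_gen (rmap_gen _ _ (step_trans k h)) /gen ab.
by rewrite turns_period turns0 /= /GRing.scale /= mulr1.
Qed.

Definition sumP (s : seq S1) : rep := foldr (fun p V => dsum (P p) V) rep0 s.

Definition finitely_generated (V : rep) :=
  exists s : seq S1, exists f : hom (sumP s) V, epi f.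

Lemma P_projective p : projective (P p).
Proof.
move=> X Y g f eg; have [x gx] := eg p (f p (gen (step0 p))).
exists (hom_gen x) => q v.
apply: (hom_gen_uniq (f := hom_comp g (hom_gen x)) (g := f)).
by rewrite -gx -[in RHS](hom_genE x).
Qed.

Definition inl_fun (U V : lmodType R) (x : U) : (U * V)%type := (x, 0).
Definition inr_fun (U V : lmodType R) (x : V) : (U * V)%type := (0, x).
Lemma inl_fun_linear (U V : lmodType R) : linear (@inl_fun U V).
Proof. by move=> c x y; congr pair; rewrite /= scaler0 addr0. Qed.
Lemma inr_fun_linear (U V : lmodType R) : linear (@inr_fun U V).
Proof. by move=> c x y; congr pair; rewrite /= scaler0 addr0. Qed.
HB.instance Definition _ (U V : lmodType R) :=
  GRing.isLinear.Build R U (U * V)%type _ (@inl_fun U V) (@inl_fun_linear U V).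
HB.instance Definition _ (U V : lmodType R) :=
  GRing.isLinear.Build R V (U * V)%type _ (@inr_fun U V) (@inr_fun_linear U V).

Definition hom_inl V W : hom V (dsum V W).
Proof.
by exists (fun p => @inl_fun _ _ : {linear V p -> (V p * W p)%type}) => a p q h v; rewrite /= /pair_fun /= linear0.
Defined.
Definition hom_inr V W : hom W (dsum V W).
Proof.
by exists (fun p => @inr_fun _ _ : {linear W p -> (V p * W p)%type}) => a p q h v; rewrite /= /pair_fun /= linear0.
Defined.

Definition hom_fst V W : hom (dsum V W) V.
Proof. by exists (fun p => fst : {linear (V p * W p)%type -> V p}) => a p q h v. Defined.

Definition copair_fun (U V W : lmodType R) (f : U -> W) (g : V -> W)
  (x : (U * V)%type) : W := f x.1 + g x.2.
Lemma copair_fun_linear (U V W : lmodType R)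
  (f : {linear U -> W}) (g : {linear V -> W}) : linear (copair_fun f g).
Proof.
by move=> c x y; rewrite /copair_fun /= !linearP scalerDr addrACA.
Qed.
HB.instance Definition _ (U V W : lmodType R)
  (f : {linear U -> W}) (g : {linear V -> W}) :=
  GRing.isLinear.Build R (U * V)%type W _ (copair_fun f g) (copair_fun_linear f g).

Definition hom_copair V W X (f : hom V X) (g : hom W X) : hom (dsum V W) X.
Proof.
exists (fun p => copair_fun (f p) (g p) :
  {linear (V p * W p)%type -> X p}) => a p q h v /=.
by rewrite /copair_fun /= linearD /= !hom_nat.
Defined.

Lemma dsum_projective V W : projective V -> projective W -> projective (dsum V W).
Proof.
move=> pV pW X Y g f eg.
have [h1 E1] := pV X Y g (hom_comp f (hom_inl V W)) eg.
have [h2 E2] := pW X Y g (hom_comp f (hom_inr V W)) eg.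
exists (hom_copair h1 h2) => p [v w].
rewrite /= /copair_fun linearD /= E1 E2 /= -linearD /=; congr (f p (_, _)).
  by rewrite /= addr0.
by rewrite /= add0r.
Qed.

Lemma sumP_cat s1 s2 : exists f : hom (sumP (s1 ++ s2)) (dsum (sumP s1) (sumP s2)),
  epi f.
Proof.
elim: s1 => [|p s1 [f ef]] /=.
  exists (hom_inr _ _) => p [z w]; exists w; congr pair.
  by rewrite [z]thinmx0.
exists (hom_copair (hom_comp (hom_inl _ _) (hom_inl _ _))
   (hom_comp (hom_dsum (hom_inr (P p) (sumP s1)) (hom_id _)) f)).
move=> q [[x y] w]; have [v fv] := ef q (y, w).
exists (x, v); rewrite /= /copair_fun /= fv /pair_fun /=.
congr ((_, _), _); rewrite /= ?addr0 ?add0r //.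
Qed.

Lemma dsum_fg V W : finitely_generated V -> finitely_generated W ->
  finitely_generated (dsum V W).
Proof.
move=> [s1 [f1 e1]] [s2 [f2 e2]]; have [f ef] := sumP_cat s1 s2.
exists (s1 ++ s2), (hom_comp (hom_dsum f1 f2) f) => p [v w].
have [x <-] := e1 p v; have [y <-] := e2 p w.
by have [u fu] := ef p (x, y); exists u; rewrite /= fu.
Qed.

Lemma P_fg p : finitely_generated (P p).
Proof. by exists [:: p], (hom_fst _ _) => q v; exists (v, 0). Qed.

(* The endomorphism of V (+) W with matrix [[0, f], [g, 0]]. *)

Definition antidiag_fun (U V : lmodType R) (f : V -> U) (g : U -> V)
  (x : (U * V)%type) : (U * V)%type := (f x.2, g x.1).
Lemma antidiag_fun_linear (U V : lmodType R)
  (f : {linear V -> U}) (g : {linear U -> V}) : linear (antidiag_fun f g).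
Proof. by move=> c x y; rewrite /antidiag_fun /= !linearP. Qed.
HB.instance Definition _ (U V : lmodType R)
  (f : {linear V -> U}) (g : {linear U -> V}) :=
  GRing.isLinear.Build R (U * V)%type (U * V)%type _ (antidiag_fun f g)
    (antidiag_fun_linear f g).

Definition antidiag V W (f : hom W V) (g : hom V W) : hom (dsum V W) (dsum V W).
Proof.
exists (fun p => antidiag_fun (f p) (g p) :
  {linear (V p * W p)%type -> (V p * W p)%type}) => a p q h v /=.
by rewrite /antidiag_fun /pair_fun /= !hom_nat.
Defined.

Record Fpi := FPi {
  Frep :> rep;
  Fd : hom Frep Frep;
  Ffg : finitely_generated Frep;
  Fproj : projective Frep;
  Fdd : forall p v, Fd p (Fd p v) = t *: v }.

(* Morphisms are compared pointwise; equations between composites below are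
   stated on elements. *)
Record Fmor (X Y : Fpi) := FMor {
  Fhom :> hom X Y;
  Fcomm : forall p v, Fhom p (Fd X p v) = Fd Y p (Fhom p v) }.

Definition Fexact (X Y Z : Fpi) (f : Fmor X Y) (g : Fmor Y Z) : Prop :=
  [/\ mono f, forall p y, g p y = 0 <-> exists x, f p x = y & epi g].

Definition Fprojective (M : Fpi) : Prop :=
  forall (X Y Z : Fpi) (f : Fmor X Y) (g : Fmor Y Z), Fexact f g ->
  forall k : Fmor M Z, exists h : Fmor M Y, forall p v, g p (h p v) = k p v.

Definition Finjective (M : Fpi) : Prop :=
  forall (X Y Z : Fpi) (f : Fmor X Y) (g : Fmor Y Z), Fexact f g ->
  forall k : Fmor X M, exists h : Fmor Y M, forall p v, h p (f p v) = k p v.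

Definition Fiso (X Y : Fpi) : Prop :=
  exists (f : Fmor X Y) (g : Fmor Y X),
    (forall p v, g p (f p v) = v) /\ (forall p w, f p (g p w) = w).

Definition Fzero (X : Fpi) : Prop := forall p (v : X p), v = 0.

Definition Fdsum (X Y : Fpi) : Fpi.
Proof.
exists (dsum X Y) (hom_dsum (Fd X) (Fd Y)).
- exact: dsum_fg (Ffg X) (Ffg Y).
- exact: dsum_projective (@Fproj X) (@Fproj Y).
- by move=> p [v w]; rewrite /= /pair_fun /= !Fdd.
Defined.

Definition Findecomposable (X : Fpi) : Prop :=
  ~ Fzero X /\ forall Y Z : Fpi, Fiso X (Fdsum Y Z) -> Fzero Y \/ Fzero Z.

Lemma E_step_alpha (x y : RR) : x <= y <= x + period ->
  step (y - x) (cls y) (cls x).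
Proof. by move=> /andP[xy _]; rewrite step_cls ?subr_ge0 ?subKr. Qed.

Lemma E_step_beta (x y : RR) : x <= y <= x + period ->
  step (x + period - y) (cls x) (cls y).
Proof.
move=> /andP[_ yx]; rewrite /step subr_ge0 yx /= !clsB clsD.
by rewrite cls_period addr0 subKr.
Qed.

Definition E (x y : RR) (xy : x <= y <= x + period) : Fpi.
Proof.
exists (dsum (P (cls x)) (P (cls y)))
  (antidiag (push (E_step_beta xy)) (push (E_step_alpha xy))).
- exact: dsum_fg (@P_fg _) (@P_fg _).
- exact: dsum_projective (@P_projective _) (@P_projective _).
- move=> p [v w]; congr pair; apply: push_push; ring.
Defined.

Lemma Exx_bounds (x : RR) : x <= x <= x + period.
Proof. by rewrite lexx lerDl ltW // period_gt0. Qed.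

(* The matrix of d on E(x, x) is [[0, t], [1, 0]]. *)
Lemma Exx_d (x : RR) p (v w : P (cls x) p) :
  Fd (E (Exx_bounds x)) p (v, w) = (t *: w, v).
Proof.
congr pair.
  apply: (hom_gen_uniq (g := hom_scale _ t)).
  rewrite push_gen /gen addrAC subrr add0r turns_period turns0.
  by rewrite /= /GRing.scale /= mulr1.
apply: (hom_gen_uniq (g := hom_id _)).
by rewrite push_gen /gen subrr.
Qed.

End Representations.

(* Main.v *)
From HB Require Import structures.
From mathcomp Require Import all_boot all_order all_algebra.
From mathcomp Require Import boolp classical_sets reals ring.
Require Import Defs.

Set Implicit Arguments.
Unset Strict Implicit.
Unset Printing Implicit Defensive.

(** Let (X, d) be relatively projective.  The object X (+) X with
    d (a, b) = (t b, a) is free on the representation X, and (a, b) |-> a + d b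
    is a deflation from it onto X whose kernel is (X, -d).  A section of this
    deflation amounts to an endomorphism s of the representation X with
    s d + d s = 1 ([Fprojective_contraction]).

    If X <> 0, its representation has a free summand: some P_p -> X -> P_p,
    sending e_p to v and then to h v, has h v a unit of R ([unit_coordinate]).
    The base ring R is local, so in h v = h (s (d v)) + h (d (s v)) one of the
    two terms is a unit, and after replacing h by h s or v by s v the
    coefficient h (d v) is a unit ([unit_coordinate_d]).

    For p = [x], morphisms E(x,x) -> X correspond to vectors v of X[p] and
    morphisms X -> E(x,x) to morphisms h : X -> P_p.  The composite
    E(x,x) -> X -> E(x,x) given by v and h is multiplication by u + w d with
    u = h (d v) and w = h v.  Since t is not a unit, u^2 - t w^2 is one, and
    (u - w d) / (u^2 - t w^2) is an inverse; absorbing it into h yields a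
    retraction of X onto E(x,x) ([dual_coordinate_d], [Exx_retract]).  A
    nonzero retract of an indecomposable object is isomorphic to it
    ([retract_of_indecomposable]). *)

Import GRing.Theory.
Local Open Scope ring_scope.

(** * Non-units of a discrete valuation ring *)

Section LocalRing.
Variable R : idomainType.

Lemma multiples_idealr_closed (x : R) : x \isn't a GRing.unit ->
  idealr_closed [pred y : R | `[< exists r, y = r * x >]].
Proof.
move=> xN; split; rewrite ?inE.
- by exists 0; rewrite mul0r.
- apply: contra xN => /asboolP[r r1].
  by apply/unitrP; exists r; rewrite [x * r]mulrC -r1.
- move=> a u v; rewrite !inE => -[r ->] [s ->].
  by exists (a * r + s); rewrite mulrDl mulrA.
Qed.

(** Zorn's lemma, applied to the proper ideals containing x. *)
Lemma nonunit_in_maximal (x : R) : x \isn't a GRing.unit ->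
  exists2 M : {pred R}, maximal_ideal M & x \in M.
Proof.
move=> xN.
pose J (A : set R) := idealr_closed [pred y | `[< A y >]] /\ A x.
have J_xR : J (fun y => exists r, y = r * x).
  by split; [exact: multiples_idealr_closed | exists 1; rewrite mul1r].
(* The union of the empty chain is empty, so the empty set has to be let in. *)
have [|A [JA Amax]] := @Zorn_bigcup R (fun A => A = set0 \/ J A).
  move=> F FJ Ftot.
  have [[A [FA [y Ay]]]|F0] := pselect (exists A, F A /\ exists y, A y); last first.
    left; rewrite -subset0 => y [A FA Ay].
    by apply: F0; exists A; split=> //; exists y.
  have JF B z : F B -> B z -> J B.
    by move=> FB Bz; case: (FJ B FB) => // B0; rewrite B0 in Bz.
  have [[A0 _ _] Ax] := JF A y FA Ay; rewrite inE in A0.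
  right; split; last by exists A.
  split; rewrite ?inE; first by exists A.
    apply/asboolP=> -[B FB B1].
    by have [[_ + _] _] := JF B 1 FB B1; rewrite inE => /asboolP.
  move=> a u v; rewrite !inE => -[B FB Bu] [C FC Cv].
  have lin D : F D -> D u -> D v -> (\bigcup_(X in F) X)%classic (a * u + v).
    move=> FD Du Dv; have [[_ _ D_lin] _] := JF D u FD Du.
    by exists D => //; move: (D_lin a u v); rewrite !inE; exact.
  have [BC|CB] := Ftot B C FB FC; first by apply: (lin C) => //; exact: BC.
  by apply: (lin B) => //; exact: CB.
case: JA => [A0|[A_id Ax]].
  case: (Amax (fun y => exists r, y = r * x)); last by right.
  rewrite A0; split; first exact: sub0set.
  by move=> /(_ x); apply; exists 1; rewrite mul1r.
exists ([pred y | `[< A y >]] : {pred R}); last by rewrite inE.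
split=> // K K_id AK y; apply/idP/idP; last exact: AK.
move=> Ky; rewrite inE; apply: contrapT => nAy.
apply: (Amax (fun z => z \in K)).
  split=> [z Az|/(_ y Ky)//]; apply: AK; rewrite inE; exact: Az.
right; split; last by apply: AK; rewrite inE.
have -> // : [pred z | `[< z \in K >]] = K :> (R -> bool).
by apply/funext => z; rewrite /= asboolb.
Qed.

Lemma dvr_nonunits : is_dvr R ->
  exists2 M : {pred R}, maximal_ideal M &
    forall x, (x \in M) = (x \isn't a GRing.unit).
Proof.
move=> [_ [M M_max M_uniq] _]; exists M => // x; apply/idP/idP => [xM|].
  have [[M0 M1 M_lin] _] := M_max.
  apply: contra M1 => xU.
  by have := M_lin x^-1 x 0 xM M0; rewrite addr0 mulVr.
by move=> /nonunit_in_maximal[N N_max xN]; rewrite -(M_uniq N N_max).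
Qed.

(** R is local: otherwise a and b, hence a + b, lie in the maximal ideal. *)
Lemma dvr_unitD (a b : R) : is_dvr R -> a + b \is a GRing.unit ->
  a \is a GRing.unit \/ b \is a GRing.unit.
Proof.
move=> /dvr_nonunits[M [[_ _ M_lin] _] ME] abU.
have [aU|aN] := boolP (a \is a GRing.unit); first by left.
right; apply: contraLR abU => bN.
by rewrite -ME -[a]mul1r M_lin ?ME.
Qed.

(** This is the norm of u + w d when d^2 = t; modulo the maximal ideal it is
    u^2. *)
Lemma dvr_unit_sqrBt (t u w : R) : is_dvr R -> is_uniformizer t ->
  u \is a GRing.unit -> u * u - t * (w * w) \is a GRing.unit.
Proof.
move=> R_dvr t_unif uU; have [M M_max ME] := dvr_nonunits R_dvr.
have tM : t \in M by apply/(t_unif M M_max); exists 1; rewrite mul1r.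
have [[M0 _ M_lin] _] := M_max.
apply: contraLR isT => DN; have : u * u \in M.
  have -> : u * u = 1 * (u * u - t * (w * w)) + (w * w * t + 0) by ring.
  by apply: (M_lin); [rewrite ME | apply: (M_lin)].
by rewrite ME unitrM uU.
Qed.

End LocalRing.

(** * Kernels and complements *)

Section Kernel.
Variables (R : idomainType) (V W : lmodType R) (f : {linear V -> W}).

Definition ker_pred : {pred V} := [pred v | f v == 0].

Lemma ker_submod_closed : submod_closed ker_pred.
Proof.
split=> [|a u v]; rewrite !inE ?linear0 // => /eqP fu /eqP fv.
by rewrite linearP fu fv scaler0 addr0.
Qed.
HB.instance Definition _ := GRing.isSubmodClosed.Build R V ker_pred
  (GRing.submod_closed_semi ker_submod_closed).

Record ker := Ker { ker_val :> V; ker_valP : ker_val \in ker_pred }.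
HB.instance Definition _ := [isSub for ker_val].
HB.instance Definition _ := [Choice of ker by <:].
HB.instance Definition _ := [SubChoice_isSubLmodule of ker by <:].

End Kernel.

Section Angular.
Variables (RR : realType) (R : idomainType) (t : R).
Implicit Types V W U : rep RR t.
Implicit Types X Y Z : Fpi RR t.
Implicit Types p q : circle RR.
Local Notation e p := (gen t (step0 p)).

Section KernelRep.
Variables (V W : rep RR t) (f : hom V W).

Definition ker_map_fun a p q (h : step a p q) (v : ker (f p)) : ker (f q).
Proof.
exists (rmap V h (val v)).
by case: v => v /= /eqP fv; rewrite inE -hom_nat fv linear0.
Defined.

Lemma ker_map_linear a p q (h : step a p q) : linear (ker_map_fun h).
Proof. by move=> c u v; apply: val_inj; rewrite /= !linearP. Qed.

HB.instance Definition _ a p q (h : step a p q) :=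
  GRing.isLinear.Build R (ker (f p)) (ker (f q)) _ (ker_map_fun h)
    (ker_map_linear h).

Definition rep_ker : rep RR t.
Proof.
exists (fun p => ker (f p) : lmodType R) (fun a p q h => ker_map_fun h).
- by move=> a b p q r hb ha hab v; apply: val_inj; exact: rmap_comp.
- by move=> n p h v; apply: val_inj; rewrite linearZ; exact: rmap_loop.
Defined.

Definition ker_incl : hom rep_ker V.
Proof. by exists (fun p => val : {linear ker (f p) -> V p}). Defined.

Section Corestriction.
Variables (U : rep RR t) (g : hom U V) (fg : forall p u, f p (g p u) = 0).

Definition corestr_fun p (u : U p) : ker (f p).
Proof. by exists (g p u); rewrite inE fg. Defined.

Lemma corestr_linear p : linear (@corestr_fun p).
Proof. by move=> c u v; apply: val_inj; rewrite /= linearP. Qed.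

HB.instance Definition _ p :=
  GRing.isLinear.Build R (U p) (ker (f p)) _ (@corestr_fun p)
    (@corestr_linear p).

Definition corestr : hom U rep_ker.
Proof.
exists (fun p => @corestr_fun p : {linear U p -> ker (f p)}) => a p q h u.
by apply: val_inj; exact: hom_nat.
Defined.

End Corestriction.
End KernelRep.

Lemma retract_projective V W (i : hom W V) (r : hom V W) :
  (forall p w, r p (i p w) = w) -> projective V -> projective W.
Proof.
move=> ri V_proj A B g f g_epi.
have [h gh] := V_proj A B g (hom_comp f r) g_epi.
by exists (hom_comp h i) => p w /=; rewrite gh /= ri.
Qed.

Lemma quotient_fg V W (r : hom V W) :
  epi r -> finitely_generated V -> finitely_generated W.
Proof.
move=> r_epi [s [f f_epi]]; exists s, (hom_comp r f) => p w.
by have [v <-] := r_epi p w; have [u <-] := f_epi p v; exists u.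
Qed.

Definition lincomb_fun (V W : lmodType R) (a b : R) (f g : V -> W) v : W :=
  a *: f v + b *: g v.

Lemma lincomb_linear (V W : lmodType R) a b (f g : {linear V -> W}) :
  linear (lincomb_fun a b f g).
Proof.
move=> c u v; rewrite /lincomb_fun (linearP f) (linearP g) !scalerDr !scalerA.
by rewrite [a * c]mulrC [b * c]mulrC addrACA.
Qed.

HB.instance Definition _ (V W : lmodType R) a b (f g : {linear V -> W}) :=
  GRing.isLinear.Build R V W _ (lincomb_fun a b f g) (lincomb_linear a b f g).

Definition hom_lincomb V W (a b : R) (f g : hom V W) : hom V W.
Proof.
exists (fun p => lincomb_fun a b (f p) (g p) : {linear V p -> W p}) => c p q h v.
by rewrite /= /lincomb_fun linearP linearZ /= !hom_nat.
Defined.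

Lemma hom_lincombE V W (a b : R) (f g : hom V W) p v :
  hom_lincomb a b f g p v = a *: f p v + b *: g p v.
Proof. by []. Qed.

(** A retract Y of X in F_pi is a direct summand: the kernel of the retraction
    g is stable under d, and as an image of 1 - f g it inherits finite
    generation and projectivity from X. *)
Section Splitting.
Variables (X Y : Fpi RR t) (f : Fmor Y X) (g : Fmor X Y).
Hypothesis gf : forall p y, g p (f p y) = y.

Definition complement_proj_hom : hom X X :=
  hom_lincomb 1 (-1) (hom_id X) (hom_comp f g).

Lemma complement_projE p x : complement_proj_hom p x = x - f p (g p x).
Proof. by rewrite /= /lincomb_fun scale1r scaleN1r. Qed.

Lemma complement_proj_ker p x : g p (complement_proj_hom p x) = 0.
Proof. by rewrite complement_projE linearB /= gf subrr. Qed.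

Let pr := corestr complement_proj_ker.

Lemma complement_incl_proj p x : ker_incl g p (pr p x) = x - f p (g p x).
Proof. exact: complement_projE. Qed.

Lemma complement_proj_incl p z : pr p (ker_incl g p z) = z.
Proof.
apply: val_inj; rewrite -[LHS]/(ker_incl g p (pr p _)) complement_incl_proj.
by case: z => z /= /eqP ->; rewrite linear0 subr0.
Qed.

Lemma complement_d_ker p z : g p (Fd X p (ker_incl g p z)) = 0.
Proof. by case: z => z /= /eqP gz; rewrite Fcomm gz linear0. Qed.

Definition complement : Fpi RR t.
Proof.
exists (rep_ker g)
  (corestr (g := hom_comp (Fd X) (ker_incl g)) complement_d_ker).
- apply: (quotient_fg (r := pr) _ (Ffg X)) => p z.
  by exists (ker_incl g p z); rewrite complement_proj_incl.
- exact: (retract_projective complement_proj_incl (@Fproj _ _ _ X)).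
- by move=> p z; apply: val_inj; rewrite linearZ; exact: Fdd.
Defined.

Lemma complement_iso : Fiso X (Fdsum Y complement).
Proof.
pose i_hom : hom X (Fdsum Y complement) := hom_lincomb 1 1
  (hom_comp (hom_inl Y complement) g) (hom_comp (hom_inr Y complement) pr).
have iE p x : i_hom p x = (g p x, pr p x).
  by rewrite /= /lincomb_fun !scale1r; congr pair; rewrite /= ?addr0 ?add0r.
have i_comm p x : i_hom p (Fd X p x) = Fd (Fdsum Y complement) p (i_hom p x).
  rewrite !iE /= /pair_fun Fcomm /=; congr pair; apply: val_inj.
  rewrite -[LHS]/(ker_incl g p (pr p _)) complement_incl_proj.
  by rewrite /= complement_projE linearB /= !Fcomm.
pose j_hom : hom (Fdsum Y complement) X := hom_copair f (ker_incl g).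
have j_comm p w : j_hom p (Fd (Fdsum Y complement) p w) = Fd X p (j_hom p w).
  by case: w => y z; rewrite /= /copair_fun /= linearD /= Fcomm.
exists (FMor i_comm), (FMor j_comm); split=> [p x|p [y z]].
  rewrite -[LHS]/(j_hom p (i_hom p x)) iE.
  rewrite -[LHS]/(f p (g p x) + ker_incl g p (pr p x)).
  by rewrite complement_incl_proj addrC subrK.
rewrite -[LHS]/(i_hom p (f p y + ker_incl g p z)) iE.
have gz : g p (ker_incl g p z) = 0 by case: z => z /= /eqP.
have gj : g p (f p y + ker_incl g p z) = y by rewrite linearD gf gz addr0.
rewrite gj; congr pair.
apply: val_inj; rewrite -[LHS]/(ker_incl g p (pr p _)) complement_incl_proj.
by rewrite gj addrAC subrr add0r.
Qed.

Lemma retract_of_indecomposable : Findecomposable X -> ~ Fzero Y -> Fiso X Y.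
Proof.
move=> [_ X_indec] Y_neq0.
have [//|Z0] := X_indec Y complement complement_iso.
exists g, f; split=> // p x; apply/esym/eqP; rewrite -subr_eq0.
by rewrite -complement_incl_proj (Z0 p (pr p x)) linear0.
Qed.

End Splitting.

(** * Relative projectivity as a contraction of d *)

Section Contraction.
Variable X : Fpi RR t.

(** The free object of F_pi on the representation underlying X; the same
    construction on P_[x] gives E(x,x). *)
Definition doubled : Fpi RR t.
Proof.
exists (dsum X X) (antidiag (hom_scale X t) (hom_id X)).
- exact: dsum_fg (Ffg X) (Ffg X).
- exact: dsum_projective (@Fproj _ _ _ X) (@Fproj _ _ _ X).
- by move=> p [v w].
Defined.

Definition opposite : Fpi RR t.
Proof.
exists X (hom_comp (hom_scale X (-1)) (Fd X)).
- exact: Ffg.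
- exact: Fproj.
- by move=> p v; rewrite /= linearZ /= Fdd !scalerA mulrNN mulr1 mul1r.
Defined.

Definition doubled_incl_hom : hom X (dsum X X) :=
  hom_lincomb (-1) 1 (hom_comp (hom_inl X X) (Fd X)) (hom_inr X X).

Lemma doubled_inclE p v : doubled_incl_hom p v = (- Fd X p v, v).
Proof.
by congr pair; rewrite /= scaler0 ?addr0 ?add0r ?scale1r ?scaleN1r.
Qed.

Definition doubled_incl : Fmor opposite doubled.
Proof.
exists doubled_incl_hom => p v; rewrite !doubled_inclE /= scaleN1r.
by congr pair; rewrite /= linearN /= opprK Fdd.
Defined.

Definition doubled_proj : Fmor doubled X.
Proof.
exists (hom_copair (hom_id X) (Fd X)) => p [v w].
by rewrite /= /copair_fun /= linearD /= Fdd addrC.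
Defined.

Lemma doubled_exact : Fexact doubled_incl doubled_proj.
Proof.
split=> [p u v|p [v w]|p v].
- rewrite -[LHS]/(doubled_incl_hom p u) -[RHS]/(doubled_incl_hom p v).
  by rewrite !doubled_inclE => -[].
- rewrite -[doubled_proj p _]/(v + Fd X p w); split.
    move=> /eqP; rewrite addr_eq0 => /eqP ->; exists w; exact: doubled_inclE.
  move=> [u]; rewrite -[X in X = _]/(doubled_incl_hom p u) doubled_inclE.
  move=> -[<- <-].
  by rewrite addNr.
- by exists (v, 0); rewrite /= /copair_fun /= linear0 addr0.
Qed.

(** A section v |-> (s1 v, s2 v) of [doubled_proj] commutes with d, whence
    s1 v = s2 (d v), and the section equation s1 v + d (s2 v) = v is the claim
    for s = s2. *)
Lemma Fprojective_contraction : Fprojective X ->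
  exists s : hom X X, forall p v, s p (Fd X p v) + Fd X p (s p v) = v.
Proof.
move=> X_proj.
have id_comm p v : hom_id X p (Fd X p v) = Fd X p (hom_id X p v) by [].
have [s sP] := X_proj _ _ _ _ _ doubled_exact (FMor id_comm).
(* The copairing of 0 and 1 is the second projection. *)
exists (hom_comp (hom_copair (hom_scale X 0) (hom_id X)) s) => p v.
have := sP p v; have := Fcomm s v.
rewrite /= /copair_fun /= !scale0r !add0r => ->.
by case: (s p v).
Qed.

End Contraction.

(** * Free summands *)

Lemma genE (p : circle RR) : e p = 1.
Proof. by rewrite /gen turns0 expr0. Qed.

(** Let v be the image of the generator e_p.  A section of f writes
    v = r v + f2 b, where f2 is the restriction of f to W; when r is not a
    unit, 1 - r is one by locality, so that v is in the image of f2 and the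
    generator is superfluous. *)
Lemma drop_generator V W p (f : hom (dsum (P t p) W) V) :
  is_dvr R -> projective V -> epi f ->
  (exists (v : V p) (h : hom V (P t p)), (h p v : R) \is a GRing.unit) \/
  epi (hom_comp f (hom_inr (P t p) W)).
Proof.
move=> R_dvr V_proj f_epi.
have [j fj] := V_proj _ _ f (hom_id V) f_epi.
pose f1 := hom_comp f (hom_inl (P t p) W).
pose f2 := hom_comp f (hom_inr (P t p) W).
have fE q a b : f q (a, b) = f1 q a + f2 q b.
  rewrite -[RHS]/(f q (a, 0) + f q (0, b)) -linearD.
  by congr (f q (_, _)); rewrite /= ?addr0 ?add0r.
pose v := f1 p (e p); pose r : R := (j p v).1.
have [rU|rN] := boolP (r \is a GRing.unit).
  by left; exists v, (hom_comp (hom_fst _ _) j).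
right.
have cU : 1 - r \is a GRing.unit.
  have [||] := @dvr_unitD _ r (1 - r) R_dvr; rewrite ?(negPf rN) //.
  by rewrite addrC subrK unitr1.
have f1r : f1 p r = r *: v.
  by rewrite -linearZ genE /GRing.scale /= mulr1.
have f2c : f2 p ((1 - r)^-1 *: (j p v).2) = v.
  rewrite linearZ; have -> : f2 p (j p v).2 = (1 - r) *: v.
    rewrite scalerBl scale1r -f1r; apply/esym/eqP; rewrite subr_eq addrC -fE.
    by rewrite -surjective_pairing fj.
  by rewrite /= scalerA mulVr // scale1r.
have f1E q a : f1 q a = f2 q (hom_gen ((1 - r)^-1 *: (j p v).2) q a).
  apply: (hom_gen_uniq (g := hom_comp f2 (hom_gen _))).
  by rewrite -[RHS]/(f2 p (hom_gen _ p (e p))) hom_genE f2c.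
move=> q w; have [[a b] <-] := f_epi q w.
exists (hom_gen ((1 - r)^-1 *: (j p v).2) q a + b).
by rewrite -/f2 fE f1E linearD.
Qed.

(** Superfluous generators cannot be dropped forever, as V is nonzero. *)
Lemma unit_coordinate V : is_dvr R -> finitely_generated V -> projective V ->
  ~ (forall p (v : V p), v = 0) ->
  exists p (v : V p) (h : hom V (P t p)), (h p v : R) \is a GRing.unit.
Proof.
move=> R_dvr [s [f f_epi]] V_proj V_neq0.
elim: s f f_epi => [|p s IHs] f f_epi.
  case: V_neq0 => p v; have [w <-] := f_epi p v.
  by rewrite [w]thinmx0 linear0.
have [ex|f2_epi] := drop_generator R_dvr V_proj f_epi; first by exists p.
exact: IHs f2_epi.
Qed.

(** Apply h to v = s (d v) + d (s v): one of the two terms is a unit. *)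
Lemma unit_coordinate_d X : is_dvr R -> Fprojective X -> ~ Fzero X ->
  exists p (v : X p) (h : hom X (P t p)),
    (h p (Fd X p v) : R) \is a GRing.unit.
Proof.
move=> R_dvr X_proj X_neq0; have [s sd] := Fprojective_contraction X_proj.
have [p [v [h hvU]]] := unit_coordinate R_dvr (Ffg X) (@Fproj _ _ _ X) X_neq0.
rewrite -(sd p v) linearD in hvU.
have [hsU|hsU] := dvr_unitD R_dvr hvU.
  by exists p, v, (hom_comp h s).
by exists p, (s p v), h.
Qed.

(** With u = h (d v) and w = h v, the corrected coordinate is
    (u h - w h d) / (u^2 - t w^2). *)
Lemma dual_coordinate_d X : is_dvr R -> is_uniformizer t ->
  Fprojective X -> ~ Fzero X ->
  exists p (v : X p) (h : hom X (P t p)),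
    h p (Fd X p v) = (1 : R) /\ h p v = (0 : R).
Proof.
move=> R_dvr t_unif X_proj X_neq0.
have [p [v [h hU]]] := unit_coordinate_d R_dvr X_proj X_neq0.
pose u : R := h p (Fd X p v); pose w : R := h p v.
have DU := dvr_unit_sqrBt w R_dvr t_unif hU; rewrite -/u in DU.
pose D := u * u - t * (w * w).
exists p, v, (hom_lincomb (u / D) (- (w / D)) h (hom_comp h (Fd X))).
have hdd : h p (Fd X p (Fd X p v)) = t * w by rewrite Fdd linearZ.
rewrite !hom_lincombE -![hom_comp h (Fd X) p _]/(h p (Fd X p _)) hdd.
rewrite -/u -/w /GRing.scale /=; split; last by ring.
have -> : u / D * u + - (w / D) * (t * w) = D / D :> R by rewrite {3}/D; ring.
exact: divrr DU.
Qed.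

(** * Retractions onto E(x,x) *)

Section FreeOnOne.
Variables (x : RR) (X : Fpi RR t).
Local Notation Exx := (E t (Exx_bounds x)).
Local Notation Px := (P t (cls x)).

(** The morphism extending e_[x] |-> v from the first summand P_[x]; the second
    summand is the image of the first under d. *)
Definition Exx_to (v : X (cls x)) : Fmor Exx X.
Proof.
exists (hom_copair (hom_gen v) (hom_comp (Fd X) (hom_gen v))) => p [a b].
rewrite Exx_d -[LHS]/(hom_gen v p (t *: b) + Fd X p (hom_gen v p a)).
rewrite -[RHS]/(Fd X p (hom_gen v p a + Fd X p (hom_gen v p b))).
by rewrite linearD /= Fdd linearZ addrC.
Defined.

(** A morphism to E(x,x) is determined by its second component h, as
    compatibility with d makes the first one h d. *)
Definition to_Exx_hom (h : hom X Px) : hom X (dsum Px Px) :=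
  hom_lincomb 1 1 (hom_comp (hom_inl Px Px) (hom_comp h (Fd X)))
    (hom_comp (hom_inr Px Px) h).

Lemma to_Exx_homE (h : hom X Px) p v :
  to_Exx_hom h p v = (h p (Fd X p v), h p v).
Proof.
by rewrite /= /lincomb_fun !scale1r; congr pair; rewrite /= ?addr0 ?add0r.
Qed.

Definition to_Exx (h : hom X Px) : Fmor X Exx.
Proof.
exists (to_Exx_hom h) => p v.
by rewrite !to_Exx_homE [RHS]Exx_d Fdd linearZ.
Defined.

Lemma Exx_retract (v : X (cls x)) (h : hom X Px) :
  h _ (Fd X _ v) = (1 : R) -> h _ v = (0 : R) ->
  forall p y, to_Exx h p (Exx_to v p y) = y.
Proof.
move=> h1 h0 p [a b].
have hd q (c : Px q) : h q (Fd X q (hom_gen v q c)) = c.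
  apply: (hom_gen_uniq (f := hom_comp h (hom_comp (Fd X) (hom_gen v)))
    (g := hom_id _)).
  by rewrite -[LHS]/(h _ (Fd X _ (hom_gen v _ (e _)))) hom_genE h1 genE.
have hv q (c : Px q) : h q (hom_gen v q c) = 0.
  rewrite -[RHS](scale0r c).
  apply: (hom_gen_uniq (f := hom_comp h (hom_gen v)) (g := hom_scale _ 0)).
  by rewrite -[LHS]/(h _ (hom_gen v _ (e _))) hom_genE h0 /= scale0r.
rewrite [LHS]to_Exx_homE -[Exx_to v p _]/(hom_gen v p a + Fd X p (hom_gen v p b)).
rewrite !linearD !hd !hv Fdd; congr pair; last exact: add0r.
by rewrite [h p (t *: _)]linearZ hv /= scaler0 addr0.
Qed.

End FreeOnOne.

Lemma Exx_neq0 (x : RR) : ~ Fzero (E t (Exx_bounds x)).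
Proof.
move=> /(_ (cls x) (1, 0)) /(congr1 fst) /= /eqP; exact/negP/oner_neq0.
Qed.

End Angular.

Theorem corollary2p2p5 (RR : realType) (R : idomainType) (t : R)
    (R_dvr : is_dvr R) (t_unif : is_uniformizer t) (X : Fpi RR t)
    (X_indec : Findecomposable X)
    (X_proj : Fprojective X) (X_inj : Finjective X) :
  exists x : RR, Fiso X (E t (Exx_bounds x)).
Proof.
have [p] := dual_coordinate_d R_dvr t_unif X_proj X_indec.1.
rewrite -(angleK p) => -[v [h [h1 h0]]]; exists (angle p).
apply: (retract_of_indecomposable (Exx_retract h1 h0) X_indec).
exact: Exx_neq0.
Qed.
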